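(* Let $P$ be a finite abelian $p$-group. Then the mapping $$R\mapsto (K_R,1_R)$$ establishes a 1-1 correspondence between the set of all local commutative rings on $P$ and the set of all local pairs on $P$. Moreover, two local commutative rings $R_1,R_2$ on $P$ are isomorphic (as rings) if and only if the corresponding subgroups $K_{R_1}$ and $K_{R_2}$ are conjugate in $\mathrm{Aut}(P)$.
   Context: A local commutative ring on $P$ is a commutative ring $R$ with identity $1_R$, whose additive group $R^+$ is $P$ (same underlying set and same group operation), and which is local, i.e. its non-units form an ideal. For such $R$, $K_R\le\mathrm{Aut}(P)$ denotes the group of all maps $x\mapsto ux$ with $u\in R^\times$. A local pair on $P$ is a pair $(K,e)$ where $K\le\mathrm{Aut}(P)$ is an abelian group and $e\in P$ are such that $P\setminus O$ is a subgroup of $P$, where $O=e^K$ is the $K$-orbit of $e$. *)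

(* Defs.v *)
From HB Require Import structures.
From mathcomp Require Import all_boot all_order all_fingroup all_algebra.
From mathcomp Require Import classical_sets functions.

Set Implicit Arguments.
Unset Strict Implicit.
Unset Printing Implicit Defensive.

Import GRing.Theory.
Local Open Scope ring_scope.

(* Commutative ring structures whose underlying additive group is P.  The     *)
(* factory also asks for 1 != 0; this excludes no local ring, since 0 is a    *)
(* unit of the zero ring, whose non-units thus do not form an ideal.          *)
Definition comring_on (P : finZmodType) : Type := GRing.Zmodule_isComNzRing P.

(* FinRing.isNzRing takes the units to be the elements x such that            *)
(* x * y = y * x = 1 for some y.                                              *)
Definition ring_of (P : finZmodType) (R : GRing.Zmodule_isComNzRing P) :
  finComUnitRingType :=
  let A : finComNzRingType := HB.pack_for finComNzRingType (Finite.sort P) R in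
  HB.pack_for finComUnitRingType (Finite.sort P) A (FinRing.isNzRing.Build A).

Definition is_local (P : finZmodType) (R : comring_on P) : Prop :=
  idealr_closed [pred x : ring_of R | x \isn't a GRing.unit].

Definition ring_isomorphic (P : finZmodType) (R1 R2 : comring_on P) : Prop :=
  exists f : {rmorphism ring_of R1 -> ring_of R2}, bijective f.

Definition unit_maps (P : finZmodType) (R : comring_on P) : {set {perm P}} :=
  [set s : {perm P} | [exists u : ring_of R,
     (u \is a GRing.unit) && [forall x : ring_of R, s x == u * x]]].

Lemma unit_maps_group_set (P : finZmodType) (R : comring_on P) :
  group_set (unit_maps R).
Proof.
apply/group_setP; split=> [|s t].
  rewrite inE; apply/existsP; exists 1; rewrite unitr1.
  by apply/forallP => x; rewrite perm1 mul1r.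
rewrite !inE => /existsP[u /andP[Uu /forallP us]].
move=> /existsP[v /andP[Uv /forallP vt]].
apply/existsP; exists (v * u); rewrite unitrM Uu Uv.
by apply/forallP => x; rewrite permM (eqP (us x)) (eqP (vt _)) mulrA.
Qed.

Canonical unit_maps_group (P : finZmodType) (R : comring_on P) :
  {group {perm P}} := Group (unit_maps_group_set R).

(* P is read as a group for its addition, so that Aut [set: P] is Aut(P)      *)
(* and group_set says "subgroup of P".                                        *)
Definition is_local_pair (P : finZmodType) (Ke : {group {perm P}} * P) : Prop :=
  [/\ Ke.1 \subset Aut [set: P], abelian Ke.1
    & group_set (~: orbit 'P Ke.1 Ke.2)].

Definition local_pair_of (P : finZmodType) (R : comring_on P) :
  {group {perm P}} * P := (unit_maps_group R, 1 : ring_of R).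

(* Main.v *)
Require Import Defs.
From HB Require Import structures.
From mathcomp Require Import all_boot all_order all_fingroup all_algebra all_solvable.
From mathcomp Require Import boolp classical_sets functions.

(** In a local ring each element [x] is a unit or [x - 1] is one, so the
    multiplication is determined by the unit maps and [1].  Conversely, for a
    local pair [(K, e)] with orbit [O], each [x] in [P] lies in [O] or in
    [O + e], because [e] is outside the subgroup [P \ O].  Hence an
    additive map commuting with [K] is determined by its value at [e], and [x]
    is the value of such a map, namely of [k] or [k + id] with [k] in [K]; the
    product [x * y] is the image of [y] under that map.  Finally, if an
    automorphism [g] conjugates the unit maps of [R1] to those of [R2], then
    [g 1] is a unit of [R2], and [x |-> g x / g 1] is a ring isomorphism. *)

Section LocalRings.
Set Implicit Arguments.
Unset Strict Implicit.
Unset Printing Implicit Defensive.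
Import GRing.Theory.
Local Open Scope ring_scope.

Lemma Aut_setT_P (P : finZmodType) (s : {perm P}) :
  reflect {morph s : x y / x + y} (s \in Aut [set: P]).
Proof.
rewrite inE; apply: (iffP andP) => [[_ /morphicP sM] x y | sD].
  by apply: sM; rewrite inE.
split; first by apply/fintype.subsetP => x; rewrite inE.
by apply/morphicP => x y _ _; apply: sD.
Qed.

(** * Units, unit maps and the local pair of a local ring *)

Section UnitMaps.
Variables (P : finZmodType) (R : comring_on P).
Implicit Types (s : {perm P}) (u x : ring_of R).

Lemma unit_mapsP s :
  reflect (exists2 u, u \is a GRing.unit & forall x, s x = u * x)
          (s \in unit_maps R).
Proof.
rewrite inE; apply: (iffP existsP) => [[u /andP[Uu /forallP su]] | [u Uu su]].
  by exists u => // x; apply/eqP/su.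
by exists u; rewrite Uu; apply/forallP => x; rewrite su.
Qed.

Lemma unit_map u : u \is a GRing.unit ->
  exists2 s, s \in unit_maps R & forall x, s x = u * x.
Proof.
move=> Uu; pose s : {perm ring_of R} := perm (mulrI Uu).
have su x : s x = u * x by rewrite permE.
by exists s => //; apply/unit_mapsP; exists u.
Qed.

Lemma unit_maps_orbit u :
  (u \in orbit 'P (unit_maps_group R) (1%R : ring_of R)) = (u \is a GRing.unit).
Proof.
apply/orbitP/idP => [[s /unit_mapsP[v Uv sv] <-] | Uu].
  by rewrite /= apermE sv mulr1.
have [s Ks su] := unit_map Uu; exists s => //.
by rewrite /= apermE su mulr1.
Qed.

(** If [x] and [x - 1] were both non-units, the ideal of non-units would contain
    [1 = -(x - 1) + x]. *)
Lemma local_subr1_unit x :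
  is_local R -> x \isn't a GRing.unit -> x - 1 \is a GRing.unit.
Proof.
case=> _ /negP R1 Ridl Nx; apply: contrapT => /negP Nx1; case: R1.
have -> : 1 = -1 * (x - 1) + x :> ring_of R by rewrite mulN1r opprB subrK.
by apply: Ridl; rewrite inE.
Qed.

Lemma local_pair_of_local : is_local R -> is_local_pair (local_pair_of R).
Proof.
move=> Rloc; case: (Rloc) => R0 _ Ridl; split=> /=.
- apply/fintype.subsetP => s /unit_mapsP[u _ su]; apply/Aut_setT_P => x y.
  by rewrite !su; apply: (mulrDr u).
- apply/centsP => s /unit_mapsP[u _ su] t /unit_mapsP[v _ tv].
  by apply/permP => x; rewrite !permM su tv tv su mulrCA.
apply/group_setP; split=> [|x y].
  by rewrite inE (unit_maps_orbit 0).
rewrite !inE (unit_maps_orbit x) (unit_maps_orbit y) => Nx Ny.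
rewrite (unit_maps_orbit ((x : ring_of R) + y)).
by have := Ridl 1 x y; rewrite !inE (mul1r (x : ring_of R)); apply.
Qed.

End UnitMaps.

(** * Injectivity of the correspondence *)

Lemma comring_on_inj (P : finZmodType) (R1 R2 : comring_on P) :
  (1 : ring_of R1) = (1 : ring_of R2) :> P ->
  (forall x y : P, (x : ring_of R1) * y = (x : ring_of R2) * y :> P) ->
  R1 = R2.
Proof.
case: R1 => o1 m1 A1 C1 i1 D1 n1; case: R2 => o2 m2 A2 C2 i2 D2 n2 /= eo em.
have eo' : o1 = o2 := eo.
have em' : m1 = m2 by apply/funext => x; apply/funext => y; apply: em.
clear eo em; move: A2 C2 i2 D2 n2.
case: _ / eo'; case: _ / em' => *.
(* With the identity and the product identified, the remaining fields are proofs of propositions. *)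
by congr GRing.Zmodule_isComNzRing.Axioms_; apply: Prop_irrelevance.
Qed.

Lemma local_pair_of_inj (P : finZmodType) (R1 R2 : comring_on P) :
  is_local R1 -> local_pair_of R1 = local_pair_of R2 -> R1 = R2.
Proof.
move=> R1loc [eK e1].
apply: comring_on_inj => // x y.
have mulU (u : ring_of R1) :
    u \is a GRing.unit -> u * y = (u : ring_of R2) * y :> P.
  (* Multiplication by [u] in [R1] is multiplication by some [v] in [R2]; evaluating at the common
     identity gives [v = u]. *)
  move=> Uu; have [s Ks su] := unit_map Uu.
  have := Ks; rewrite eK => /unit_mapsP[v Uv sv].
  suff vu : v = u :> P by rewrite -[LHS]su sv vu.
  by rewrite -[v]mulr1 -sv -e1 su mulr1.
case: (boolP ((x : ring_of R1) \is a GRing.unit)) => [/mulU // | Nx].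
have := mulU _ (local_subr1_unit R1loc Nx); rewrite mulrBl mul1r.
have -> : (x : ring_of R1) - 1 = (x : ring_of R2) - 1 :> P.
  by congr (_ - _ : P).
rewrite (mulrBl (y : ring_of R2)) mul1r => /(congr1 (fun z : P => z + y)).
by rewrite (subrK (y : ring_of R1)) (subrK (y : ring_of R2)).
Qed.

(** * Surjectivity: the local ring of a local pair *)

Section RingOfPair.
Variables (P : finZmodType) (K : {group {perm P}}) (e : P).
Hypothesis Kloc : is_local_pair (K, e).

Let O := orbit 'P K e.

Lemma local_pair_morph k : k \in K -> {morph k : x y / x + y}.
Proof. by case: Kloc => /= KA _ _ /(fintype.subsetP KA) /Aut_setT_P. Qed.

Lemma local_pair_comm k l : k \in K -> l \in K -> forall x, k (l x) = l (k x).
Proof.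
move=> Kk Kl x; case: Kloc => /= _ /centsP cK _.
by rewrite -!permM (cK _ Kl _ Kk).
Qed.

Lemma local_pair_nonorbit0 : 0 \notin O.
Proof. by case: Kloc => /= _ _ /group_setP[]; rewrite inE. Qed.

Lemma local_pair_nonorbitD x y : x \notin O -> y \notin O -> x + y \notin O.
Proof.
case: Kloc => /= _ _ /group_setP[_ OM] Nx Ny.
by have := OM x y; rewrite !inE => /(_ Nx Ny).
Qed.

Lemma mem_orbit_perm k x : k \in K -> (k x \in O) = (x \in O).
Proof.
move=> Kk; have := actsP (acts_orbit 'P e (finset.subsetT K)) _ Kk x.
by rewrite /= apermE.
Qed.

Lemma local_pair_orbitP x : reflect (exists2 k, k \in K & k e = x) (x \in O).
Proof. by apply: (iffP orbitP) => -[k Kk] <-; exists k. Qed.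

Lemma local_pair_cases x :
  exists2 k, k \in K & x = k e \/ x = k e + e.
Proof.
have Oe : e \in O by apply: orbit_refl.
case: (boolP (x \in O)) => [/local_pair_orbitP[k Kk <-] | Nx].
  by exists k; last left.
suff /local_pair_orbitP[k Kk ek] : x - e \in O.
  by exists k; last by right; rewrite ek subrK.
have Nopp y : y \notin O -> - y \notin O.
  case: Kloc => /= _ _ gO Ny.
  by have := @groupVr _ (Group gO) y; rewrite !inE; apply.
(* Otherwise [e = -(-x + (x - e))] would lie in the subgroup [P \ O]. *)
apply: contraLR Oe => /(local_pair_nonorbitD (Nopp _ Nx)) /Nopp.
by rewrite addKr opprK.
Qed.

(** In the ring built below these are exactly the multiplications by fixed elements, [f] being
    multiplication by [f e]. *)
Definition equivariant (f : P -> P) :=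
  {morph f : x y / x + y} /\ (forall k, k \in K -> {morph f : x / k x}).

(** Such an [f] sends [k e] to [k (f e)] and [k e + e] to [k (f e) + f e], and every element has one
    of these forms. *)
Lemma equivariant_eq f g :
  equivariant f -> equivariant g -> f e = g e -> f =1 g.
Proof.
move=> [fD fK] [gD gK] efg x; have [k Kk [->|->]] := local_pair_cases x.
  by rewrite fK // gK // efg.
by rewrite fD gD fK // gK // efg.
Qed.

Lemma equivariant_perm k : k \in K -> equivariant k.
Proof.
by move=> Kk; split=> [|l Kl x]; [apply: local_pair_morph | apply: local_pair_comm].
Qed.

Lemma equivariant_permD1 k : k \in K -> equivariant (fun x => k x + x).
Proof.
move=> Kk; split=> [x y | l Kl x].
  by rewrite local_pair_morph // addrACA.
by rewrite (local_pair_morph Kl) (local_pair_comm Kk Kl).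
Qed.

Lemma equivariant_comp f g :
  equivariant f -> equivariant g -> equivariant (f \o g).
Proof.
move=> [fD fK] [gD gK]; split=> [x y | k Kk x] /=; first by rewrite gD fD.
by rewrite gK ?fK.
Qed.

Lemma equivariant_exists x : exists f, equivariant f /\ f e = x.
Proof.
have [k Kk [->|->]] := local_pair_cases x.
  by exists k; split=> //; apply: equivariant_perm.
by exists (fun y => k y + y); split=> //; apply: equivariant_permD1.
Qed.

Lemma local_ring_of_pair :
  exists2 R : comring_on P, is_local R & local_pair_of R = (K, e).
Proof.
(* By [equivariant_eq], [m x] is the only equivariant map with value [x] at [e]; it serves as
   multiplication by [x]. *)
have [m mP] := choice equivariant_exists.
have mE x : equivariant (m x) by case: (mP x).
have me x : m x e = x by case: (mP x).
have mk k : k \in K -> m (k e) =1 k.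
  by move=> Kk; apply: equivariant_eq => //; apply: equivariant_perm.
have mk1 k : k \in K -> m (k e + e) =1 (fun x => k x + x).
  by move=> Kk; apply: equivariant_eq => //; apply: equivariant_permD1.
(* The map [m x] is [k] or [k + id], and [m y] commutes with both, so [m y x = m y (m x e) = m x (m
   y e) = m x y]. *)
have mC : commutative m.
  move=> x y; have [yD yK] := mE y.
  have [k Kk [->|->]] := local_pair_cases x.
    by rewrite mk // yK // me.
  by rewrite mk1 // yD yK // me.
have mA : associative m.
  (* Both sides are equivariant in [z], so comparing them at [z = e] suffices. *)
  move=> x y z; symmetry; move: z; apply: equivariant_eq => //=.
    exact: equivariant_comp (mE x) (mE y).
  by rewrite !me.
have m1 : left_id e m by move=> x; rewrite mC me.
have mD : left_distributive m +%R.
  by move=> x y z; rewrite -!(mC z); case: (mE z).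
have e0 : e != 0.
  by apply: contraNneq local_pair_nonorbit0 => <-; apply: orbit_refl.
(* Both [k] and [k + id] preserve the subgroup [P \ O], which makes it an ideal. *)
have mN x y : y \notin O -> m x y \notin O.
  move=> Ny; have [k Kk [->|->]] := local_pair_cases x.
    by rewrite mk // mem_orbit_perm.
  by rewrite mk1 // local_pair_nonorbitD // mem_orbit_perm.
pose R : comring_on P := GRing.Zmodule_isComNzRing.Build P mA mC m1 mD e0.
(* A unit [u] outside [O] would force [e = u^-1 u] outside [O]; conversely [k e] has inverse
   [k^-1 e]. *)
have RU (u : ring_of R) : (u \is a GRing.unit) = ((u : P) \in O).
  apply/idP/local_pair_orbitP => [Uu | [k Kk eu]].
    apply/local_pair_orbitP; apply: contraT => /(mN (u^-1 : ring_of R)).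
    have -> : m (u^-1 : ring_of R) u = e by apply: (mulVr Uu).
    by rewrite orbit_refl.
  apply/unitrP; exists ((k^-1)%g e : P).
  have ee : m u ((k^-1)%g e) = e by rewrite -eu mk // permKV.
  by split; first rewrite mulrC; apply: ee.
exists R.
  split=> [||a u v]; rewrite !inE !RU.
  - exact: local_pair_nonorbit0.
  - by rewrite negbK; apply: orbit_refl.
  by move=> Nu Nv; apply: local_pair_nonorbitD => //; apply: mN.
(* Multiplication by [k e] is [k] itself, so the unit maps form [K]. *)
congr pair; apply/val_inj/setP => s /=; apply/unit_mapsP/idP => [[u]|Ks].
  rewrite RU => /local_pair_orbitP[k Kk eu] su.
  suff -> : s = k by [].
  by apply/permP => x; rewrite -(mk k Kk) eu; apply: su.
exists (s e : P); first by rewrite RU mem_orbit_perm ?orbit_refl.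
by move=> x; rewrite -[s x]mk.
Qed.

End RingOfPair.

(** * Isomorphism of rings and conjugacy of unit maps *)

Lemma isomorphic_unit_maps_conj (P : finZmodType) (R1 R2 : comring_on P) :
  ring_isomorphic R1 R2 ->
  exists2 g, g \in Aut [set: P] & unit_maps R2 = (unit_maps R1 :^ g)%g.
Proof.
case=> f [h fK hK]; pose g : {perm P} := perm (can_inj fK : injective (f : P -> P)).
have gE (x : ring_of R1) : g x = f x by rewrite permE.
(* Since [f (u x) = f u * f x], conjugation by [g] turns multiplication by [u] into multiplication
   by [f u]. *)
have gJ (s t : {perm P}) (u : ring_of R1) :
    (forall x : ring_of R1, s x = u * x) -> (s ^ g = t)%g <-> 
    (forall x : ring_of R2, t x = f u * x).
  move=> su; split=> [<- x | tu].
    by rewrite -[x]hK -[f (h x)]gE permJ su !gE rmorphM.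
  by apply/permP => x; rewrite -[x](hK x) -[f (h x)]gE permJ su tu !gE rmorphM.
exists g; first by apply/Aut_setT_P => x y; rewrite !gE; apply: (rmorphD f).
apply/setP => t; apply/unit_mapsP/imsetP => [[v Uv tv] | [s Ks ->]].
  have Uhv : h v \is a GRing.unit.
    apply/unitrP; exists (h v^-1).
    by split; apply: (can_inj fK); rewrite rmorphM !hK rmorph1 ?mulVr ?mulrV.
  have [s Ks sv] := unit_map Uhv; exists s => //.
  by apply/esym/(gJ _ _ _ sv); rewrite hK.
have [u Uu su] := unit_mapsP _ _ Ks; exists (f u); first exact: rmorph_unit.
exact/(gJ _ _ _ su).
Qed.

Lemma unit_maps_conj_isomorphic (P : finZmodType) (R1 R2 : comring_on P) g :
  is_local R1 -> is_local R2 -> g \in Aut [set: P] ->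
  unit_maps R2 = (unit_maps R1 :^ g)%g -> ring_isomorphic R1 R2.
Proof.
move=> R1loc [R20 R21 R2idl] /Aut_setT_P gD eK.
pose G : ring_of R1 -> ring_of R2 := g.
have GD : {morph G : x y / x + y} := gD.
have GM (u : ring_of R1) : u \is a GRing.unit ->
    exists2 v, v \is a GRing.unit & forall x, G (u * x) = v * G x.
  move=> Uu; have [s Ks su] := unit_map Uu.
  have : (s ^ g)%g \in unit_maps R2 by rewrite eK memJ_conjg.
  case/unit_mapsP=> v Uv sv.
  by exists v => // x; rewrite -sv permJ su.
have U1 : G 1 \is a GRing.unit.
  (* If [G 1] were a non-unit, so would be [G u = v * G 1] for each unit [u], and then
     [G x = G (x - 1) + G 1] for each non-unit [x]; but [G] takes the value [1]. *)
  apply: contraLR (unitr1 (ring_of R2)) => N1.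
  have NU u : u \is a GRing.unit -> G u \isn't a GRing.unit.
    by move=> Uu; rewrite -[u]mulr1; have [v Uv ->] := GM u Uu; rewrite unitrMr.
  suff N x : G x \isn't a GRing.unit by have := N (g^-1%g (1 : ring_of R2)); rewrite /G permKV.
  have [/NU // | Nx] := boolP (x \is a GRing.unit).
  have := R2idl 1 (G (x - 1)) (G 1); rewrite mul1r -GD subrK !inE; apply => //.
  exact/NU/local_subr1_unit.
pose f x := (G 1)^-1 * G x.
have fD : {morph f : x y / x + y} by move=> x y; rewrite /f GD mulrDr.
have f1 : f 1 = 1 by rewrite /f mulVr.
(* Here [G (u x) = v * G x] with [v = G u / G 1], that is, [v = f u]. *)
have fMU u x : u \is a GRing.unit -> f (u * x) = f u * f x.
  move=> Uu; have [v Uv vE] := GM u Uu.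
  have Gu : G u = v * G 1 by rewrite -vE mulr1.
  by rewrite /f vE Gu !(mulrCA _ v) mulVr // mulr1.
(* A non-unit [x] is [u + 1] with [u] a unit, so additivity reduces to the case of units. *)
have fM : {morph f : x y / x * y}.
  move=> x y; have [/fMU -> // | Nx] := boolP (x \is a GRing.unit).
  have := local_subr1_unit R1loc Nx.
  rewrite -{2 3}[x](subrK 1); move: (x - 1) => u Uu.
  by rewrite mulrDl mul1r !fD fMU // mulrDl f1 mul1r.
have fB : zmod_morphism f.
  by move=> x y; apply/(addIr (f y)); rewrite -fD !subrK.
pose fZ := GRing.isZmodMorphism.Build _ _ f fB.
pose fR := GRing.isMonoidMorphism.Build _ _ f (f1, fM).
pose F : {rmorphism ring_of R1 -> ring_of R2} := HB.pack f fZ fR.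
(* On the finite set [P] injectivity is enough. *)
exists F; apply: injF_bij.
by move=> x y /mulrI; rewrite unitrV => /(_ U1); apply: perm_inj.
Qed.

End LocalRings.

Theorem theorem1p5 (p : nat) (P : finZmodType)
    (p_prime : prime p) (pP : (p.-group [set: P])%g) :
  set_bij (@is_local P) (@is_local_pair P) (@local_pair_of P) /\
  (forall R1 R2 : comring_on P, is_local R1 -> is_local R2 ->
     ring_isomorphic R1 R2 <->
     exists2 g, g \in Aut [set: P] & unit_maps R2 = (unit_maps R1 :^ g)%g).
Proof.
split.
  split=> [R | R1 R2 /set_mem R1loc _ | [K e] /local_ring_of_pair[R Rloc eR]].
  - exact: local_pair_of_local.
  - exact: local_pair_of_inj.
  by exists R.
move=> R1 R2 R1loc R2loc; split; first exact: isomorphic_unit_maps_conj.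
by case=> g Ag; apply: unit_maps_conj_isomorphic.
Qed.
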